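(* $2\times4$ integer matrices may have arbitrarily large Markov complexity: for every positive integer $N$ there exists $A\in\mathbb{Z}^{2\times4}$ with $m(A)\ge N$.
   Context: For $A\in\mathbb{Z}^{m\times n}$ and $r\ge2$, the $r$-th Lawrence lifting $A^{(r)}$ is the $(rm+n)\times rn$ matrix with $r$ copies of $A$ on the block diagonal and final block row $(I_n\ I_n\ \cdots\ I_n)$. Elements of $\operatorname{Ker}_{\mathbb{Z}}(A^{(r)})$ are identified with $r\times n$ integer matrices whose rows lie in $\operatorname{Ker}_{\mathbb{Z}}(A)$ and sum to zero; the type of such an element is its number of nonzero rows. For an integer matrix $M$ with $N'$ columns, a Markov basis is a finite set $\mathcal{M}\subseteq\operatorname{Ker}_{\mathbb{Z}}(M)$ such that whenever $\mathbf{w},\mathbf{u}\in\mathbb{N}^{N'}$ with $\mathbf{w}-\mathbf{u}\in\operatorname{Ker}_{\mathbb{Z}}(M)$ there exist $\mathbf{v}_1,\ldots,\mathbf{v}_p\in\mathcal{M}\cup(-\mathcal{M})$ with $\mathbf{w}-\sum_{i\le l}\mathbf{v}_i\in\mathbb{N}^{N'}$ for all $l$ and $\mathbf{w}-\mathbf{u}=\sum_{i=1}^p\mathbf{v}_i$; it is minimal if no proper subset is a Markov basis. The universal Markov basis of $M$ is the union of all minimal Markov bases (vectors differing by sign identified). The Markov complexity $m(A)$ is the largest type of any element of the universal Markov basis of $A^{(r)}$, as $r\ge2$ varies. *)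

(* Defs.v *)
From mathcomp Require Import all_boot all_order all_algebra finmap.

Set Implicit Arguments.
Unset Strict Implicit.
Unset Printing Implicit Defensive.

Import GRing.Theory.

Local Open Scope ring_scope.

Definition nonneg_vec n (w : 'cV[int]_n) : Prop := forall i, 0 <= w i 0.

Definition in_kerZ d n (M : 'M[int]_(d, n)) (v : 'cV[int]_n) : Prop :=
  M *m v = 0.

(* The list s is v_1, ..., v_p; p = 0 is allowed, and occurs only for w = u. *)
Definition markov_connected n (B : {fset 'cV[int]_n}) (w u : 'cV[int]_n) :
    Prop :=
  exists s : seq 'cV[int]_n,
    [/\ forall v, v \in s -> (v \in B) || (- v \in B),
        forall l : nat, (l <= size s)%N ->
          nonneg_vec (w - \sum_(v <- take l s) v)
      & w - u = \sum_(v <- s) v].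

Definition markov_basis d n (M : 'M[int]_(d, n)) (B : {fset 'cV[int]_n}) :
    Prop :=
  (forall v, v \in B -> in_kerZ M v) /\
  (forall w u : 'cV[int]_n, nonneg_vec w -> nonneg_vec u ->
    in_kerZ M (w - u) -> markov_connected B w u).

Definition minimal_markov_basis d n (M : 'M[int]_(d, n))
    (B : {fset 'cV[int]_n}) : Prop :=
  markov_basis M B /\
  (forall B' : {fset 'cV[int]_n}, (B' `<` B)%fset -> ~ markov_basis M B').

(* The sign identification is left implicit: this set is closed under
   opposite, and v and - v have the same type. *)
Definition in_universal_markov_basis d n (M : 'M[int]_(d, n))
    (v : 'cV[int]_n) : Prop :=
  exists2 B : {fset 'cV[int]_n}, minimal_markov_basis M B & v \in B.

(* \sum_(i < r) m = r * m and \sum_(i < r) n = r * n, in the form expected by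
   the block matrix operations. *)
Definition lawrence_lifting m n (A : 'M[int]_(m, n)) (r : nat) :
    'M[int]_(\sum_(i < r) m + n, \sum_(j < r) n) :=
  col_mx (\mxblock_(i < r, j < r) (if i == j then A else 0))
         (\mxrow_(j < r) 1%:M).

(* The r x n matrix identified with a vector of length r * n. *)
Definition lawrence_mx n r (v : 'cV[int]_(\sum_(j < r) n)) : 'M[int]_(r, n) :=
  \matrix_(i < r) (submxcol v i)^T.

Definition lawrence_type n r (v : 'cV[int]_(\sum_(j < r) n)) : nat :=
  #|[set i : 'I_r | row i (lawrence_mx v) != 0]|.

Lemma in_kerZ_lawrenceP m n (A : 'M[int]_(m, n)) r
    (v : 'cV[int]_(\sum_(j < r) n)) :
  in_kerZ (lawrence_lifting A r) v <->
  (forall i, in_kerZ A (row i (lawrence_mx v))^T) /\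
  \sum_(i < r) row i (lawrence_mx v) = 0.
Proof.
have rowE i : row i (lawrence_mx v) = (submxcol v i)^T by rewrite rowK.
have sumE : \sum_(i < r) row i (lawrence_mx v) = (\sum_(i < r) submxcol v i)^T.
  by rewrite raddf_sum; apply: eq_bigr => i _; rewrite rowE.
have topE : (\mxblock_(i < r, j < r) (if i == j then A else 0)) *m v
    = \mxcol_(i < r) (A *m submxcol v i).
  rewrite -[v in LHS]submxcolK mul_mxblock_mxrow.
  apply/eq_mxcolP => i; rewrite (bigD1 i) //= eqxx big1 ?addr0 // => j ji.
  by rewrite eq_sym (negPf ji) mul0mx.
have botE : (\mxrow_(j < r) 1%:M) *m v = \sum_(i < r) submxcol v i.
  rewrite -[v in LHS]submxcolK mul_mxrow_mxcol.
  by apply: eq_bigr => i _; rewrite mul1mx.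
rewrite /in_kerZ /lawrence_lifting mul_col_mx topE botE sumE.
split.
  rewrite -col_mx0 => /eq_col_mx [H1 ->]; rewrite trmx0; split=> // i.
  rewrite rowE trmxK.
  by rewrite -(mxcolK (fun j => A *m submxcol v j) i) H1 submxcol0.
case=> H1 /(congr1 trmx); rewrite trmxK trmx0 => ->.
rewrite -(col_mx0 _ (\sum_(i < r) m)%N n); congr col_mx.
apply/eqP; rewrite -mxcol0; apply/eqP/eq_mxcolP => i.
by have := H1 i; rewrite rowE trmxK.
Qed.

(* m(A) = c, the maximum being attained. *)
Definition is_markov_complexity m n (A : 'M[int]_(m, n)) (c : nat) : Prop :=
  (exists (r : nat) (v : 'cV[int]_(\sum_(j < r) n)),
     [/\ (2 <= r)%N,
         in_universal_markov_basis (lawrence_lifting A r) v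
       & lawrence_type v = c]) /\
  (forall (r : nat) (v : 'cV[int]_(\sum_(j < r) n)), (2 <= r)%N ->
     in_universal_markov_basis (lawrence_lifting A r) v ->
     (lawrence_type v <= c)%N).

(* Main.v *)
Require Import Defs.
From mathcomp Require Import all_boot all_order all_algebra finmap zify.
From Stdlib Require Import Classical.

(* Upper bound: an element of a minimal Markov basis of a Lawrence lifting is
   conformally indecomposable, because the lifting has no nonzero nonnegative
   kernel vector.  Writing the rows of such an element as conformal sums of the
   (finitely many) Graver elements of A, indecomposability forces the resulting
   relation between Graver elements to be bounded by a minimal one, and Dickson's
   lemma leaves finitely many of those, independently of r.

   Lower bound: take the monomial curve with exponents 0, 1, N + 1, N + 2.  The
   binomials x0^N x2 - x1^(N+1), x1 x3^N - x2^(N+1) and x1 x2 - x0 x3 have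
   two-element fibres, and the relations between their exponent vectors are
   generated by (1, 1, N).  The (N + 2)-row matrix made of one copy of each of
   the first two vectors and N copies of the third thus has a two-element fibre
   too, so it lies, up to sign, in every Markov basis. *)

Set Implicit Arguments.
Unset Strict Implicit.
Unset Printing Implicit Defensive.

Import Order.TTheory GRing.Theory Num.Theory.

Local Open Scope ring_scope.

(** * Dickson's lemma *)

Lemma dickson (I T : eqType) (F : I -> T -> nat) (s : seq I) (P : T -> Prop) :
  exists l : seq T, (forall x, x \in l -> P x) /\
    (forall y, P y ->
      exists2 x, x \in l & forall i, i \in s -> (F i x <= F i y)%N).
Proof.
elim: s P => [|i s IHs] P.
  have [[x Px]|nP] := classic (exists x, P x).
    exists [:: x]; split=> [y|y _]; first by rewrite inE => /eqP ->.
    by exists x => //; rewrite inE.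
  by exists [::]; split=> // y Py; case: nP; exists y.
have [l [lP lE]] := IHs P.
(* The list [l] was found without regard to [i], but from height [m] on its elements lie below in
   coordinate [i] too. *)
pose m := (\max_(x <- l) F i x)%N.
have Flem x : x \in l -> (F i x <= m)%N by move=> lx; rewrite /m leq_bigmax_seq.
(* The elements with [F i y < m] split into finitely many slices. *)
have [l' [l'P l'E]] : exists l' : seq T, (forall x, x \in l' -> P x) /\
    (forall y, P y -> (F i y < m)%N ->
      exists2 x, x \in l' & forall j, j \in i :: s -> (F j x <= F j y)%N).
  elim: m {Flem} => [|m [l1 [l1P l1E]]]; first by exists [::].
  have [l2 [l2P l2E]] := IHs (fun y => P y /\ F i y = m).
  exists (l1 ++ l2); split=> [x|y Py].
    by rewrite mem_cat => /orP[/l1P|/l2P[]].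
  rewrite ltnS leq_eqVlt => /orP[/eqP Fym|lt_ym].
    have [x l2x xy] := l2E y (conj Py Fym); exists x.
      by rewrite mem_cat l2x orbT.
    move=> j; rewrite inE => /orP[/eqP ->|/xy//].
    by rewrite Fym; case: (l2P x l2x) => _ ->.
  have [x l1x xy] := l1E y Py lt_ym; exists x => //.
  by rewrite mem_cat l1x.
exists (l ++ l'); split=> [x|y Py].
  by rewrite mem_cat => /orP[/lP|/l'P].
have [lt_ym|le_my] := ltnP (F i y) m.
  by have [x l'x xy] := l'E y Py lt_ym; exists x; rewrite ?mem_cat ?l'x ?orbT.
have [x lx xy] := lE y Py; exists x; first by rewrite mem_cat lx.
move=> j; rewrite inE => /orP[/eqP ->|/xy//].
exact: leq_trans (Flem x lx) le_my.
Qed.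

(** * The conformal order, whose minimal nonzero kernel vectors are the Graver elements *)

Definition conformal n (g v : 'cV[int]_n) : Prop :=
  forall i, (0 <= g i 0 <= v i 0) || (v i 0 <= g i 0 <= 0).

Definition pos_part n (v : 'cV[int]_n) : 'cV[int]_n :=
  \col_i Num.max (v i 0) 0.

Definition norm1 n (v : 'cV[int]_n) : nat := (\sum_i `|v i 0%R|)%N.

Section Vectors.
Variable n : nat.
Implicit Types a b g u v w : 'cV[int]_n.

Lemma colP0 v w : (forall i, v i 0 = w i 0) -> v = w.
Proof. by move=> vw; apply/colP => i; rewrite vw. Qed.

(* [mxE] leaves syntactically different copies of [v i 0], which defeats [lia];
   these rules do not. *)
Lemma addvE v w i : (v + w) i 0 = v i 0 + w i 0.
Proof. by rewrite mxE. Qed.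

Lemma oppvE v i : (- v) i 0 = - v i 0.
Proof. by rewrite mxE. Qed.

Lemma zerovE i : (0 : 'cV[int]_n) i 0 = 0.
Proof. by rewrite mxE. Qed.

Lemma pos_partE v i : pos_part v i 0 = Num.max (v i 0) 0.
Proof. by rewrite mxE. Qed.

Definition vecE := (addvE, oppvE, zerovE, pos_partE).

Lemma pos_part_ge0 v : nonneg_vec (pos_part v).
Proof. by move=> i; rewrite !vecE; lia. Qed.

Lemma pos_partN v : pos_part v - v = pos_part (- v).
Proof. by apply: colP0 => i; rewrite !vecE; lia. Qed.

Lemma conformalB a v : conformal a v -> conformal (v - a) v.
Proof. by move=> av i; have := av i; rewrite !vecE; lia. Qed.

Lemma conformalN a v : conformal a v -> conformal (- a) (- v).
Proof. by move=> av i; have := av i; rewrite !vecE; lia. Qed.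

Lemma pos_part_conformal a v : conformal a v ->
  pos_part v = pos_part a + pos_part (v - a).
Proof. by move=> av; apply: colP0 => i; have := av i; rewrite !vecE; lia. Qed.

Lemma conformal_norm1 a v : conformal a v ->
  norm1 v = (norm1 a + norm1 (v - a))%N.
Proof.
move=> av; rewrite /norm1 -big_split /=; apply: eq_bigr => i _.
by have := av i; rewrite !vecE; lia.
Qed.

Lemma norm1_gt0 v : v != 0 -> (0 < norm1 v)%N.
Proof.
rewrite lt0n; apply: contraNneq => /eqP; rewrite sum_nat_eq0 => /forallP v0.
by apply/eqP/colP0 => i; rewrite vecE; have := v0 i; lia.
Qed.

(** Recording positive and negative parts as natural numbers turns the conformal order into a
    product order. *)
Lemma conformal_dickson (P : 'cV[int]_n -> Prop) :
  exists l : seq 'cV[int]_n, (forall x, x \in l -> P x) /\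
    (forall v, P v -> exists2 x, x \in l & conformal x v).
Proof.
pose F (bi : bool * 'I_n) v :=
  `|pos_part (if bi.1 then v else - v) bi.2 0%R|%N.
have [l [lP lE]] := dickson F (enum {: bool * 'I_n}) P.
exists l; split=> // v /lE[x lx xv]; exists x => // i.
have := xv (true, i) (mem_enum _ _); have := xv (false, i) (mem_enum _ _).
by rewrite /F /= !vecE; lia.
Qed.

End Vectors.

(** * Kernel vectors and Graver elements *)

Section Kernel.
Variables (d n : nat) (M : 'M[int]_(d, n)).
Implicit Types a b g u v w : 'cV[int]_n.

Lemma kerZ0 : in_kerZ M 0.
Proof. by rewrite /in_kerZ mulmx0. Qed.

Lemma kerZD v w : in_kerZ M v -> in_kerZ M w -> in_kerZ M (v + w).
Proof. by rewrite /in_kerZ mulmxDr => -> ->; rewrite addr0. Qed.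

Lemma kerZN v : in_kerZ M v -> in_kerZ M (- v).
Proof. by rewrite /in_kerZ mulmxN => ->; rewrite oppr0. Qed.

Lemma kerZB v w : in_kerZ M v -> in_kerZ M w -> in_kerZ M (v - w).
Proof. by move=> kv kw; apply: kerZD => //; apply: kerZN. Qed.

Lemma kerZMn v k : in_kerZ M v -> in_kerZ M (v *+ k).
Proof. by rewrite /in_kerZ (raddfMn (mulmx M)) /= => ->; rewrite mul0rn. Qed.

(** By minimality [G] contains all Graver elements; it may be larger, which does no harm. *)
Lemma graver_exists : exists G : seq 'cV[int]_n,
  (forall g, g \in G -> in_kerZ M g /\ g != 0) /\
  (forall v, in_kerZ M v -> v != 0 -> exists2 g, g \in G & conformal g v).
Proof.
have [G [GP GE]] := conformal_dickson (fun v => in_kerZ M v /\ v != 0).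
by exists G; split=> // v kv v0; apply: GE.
Qed.

End Kernel.

(** * Walks inside a fibre *)

Section Connected.
Variable n : nat.
Implicit Types (u v w : 'cV[int]_n) (B : {fset 'cV[int]_n}).

Lemma markov_connected_refl B w : nonneg_vec w -> markov_connected B w w.
Proof.
move=> w0; exists [::]; split=> // [l _|]; last by rewrite big_nil subrr.
by rewrite big_nil subr0.
Qed.

Lemma markov_connected_step B v w u : nonneg_vec w ->
  (v \in B) || (- v \in B) -> markov_connected B (w - v) u ->
  markov_connected B w u.
Proof.
move=> w0 vB [s [sB s0 sE]]; exists (v :: s); split.
- by move=> x; rewrite inE => /orP[/eqP ->|/sB].
- case=> [|l] /= ls; first by rewrite big_nil subr0.
  by rewrite big_cons opprD addrA; apply: s0.
- by rewrite big_cons -sE addrAC [RHS]addrC subrK.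
Qed.

(** Walks read as an inductive relation: each step subtracts [v] between two nonnegative points,
    until [u] is reached. *)
Lemma markov_connected_ind B u (P : 'cV[int]_n -> Prop) :
  (nonneg_vec u -> P u) ->
  (forall v w, nonneg_vec w -> nonneg_vec (w - v) ->
     (v \in B) || (- v \in B) -> P (w - v) -> P w) ->
  forall w, markov_connected B w u -> P w.
Proof.
move=> Pu Pstep w [s []].
elim: s w => [|v s IHs] w sB s0 sE.
  have /subr0_eq wu : w - u = 0 by rewrite sE big_nil.
  rewrite wu; apply: Pu; rewrite -wu.
  by have := s0 0%N isT; rewrite big_nil subr0.
apply: (Pstep v).
- by have := s0 0%N isT; rewrite big_nil subr0.
- by have := s0 1%N isT; rewrite /= take0 big_seq1.
- by apply: sB; rewrite mem_head.
- apply: IHs => [x sx|l ls|]; first by apply: sB; rewrite inE sx orbT.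
    by have := s0 l.+1 ls; rewrite /= big_cons opprD addrA.
  by rewrite addrAC sE big_cons addrAC subrr add0r.
Qed.

Lemma markov_connected_trans B v w u : markov_connected B w v ->
  markov_connected B v u -> markov_connected B w u.
Proof.
move=> wv vu; elim/markov_connected_ind: w / wv => // x w w0 _ xB.
exact: markov_connected_step.
Qed.

Lemma markov_connected_shift B z w u : nonneg_vec z ->
  markov_connected B w u -> markov_connected B (w + z) (u + z).
Proof.
have nnD x : nonneg_vec z -> nonneg_vec x -> nonneg_vec (x + z).
  by move=> z0 x0 i; rewrite mxE addr_ge0.
move=> z0; elim/markov_connected_ind: w / => [u0|v w w0 _ vB IH].
  exact/markov_connected_refl/nnD.
by apply: (markov_connected_step (v := v)) => //; [exact: nnD|rewrite addrAC].
Qed.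

End Connected.

(** * Existence of Markov bases, and elements they must or cannot contain *)

Section MarkovBases.
Variables (d n : nat) (M : 'M[int]_(d, n)).
Implicit Types (a e u v w : 'cV[int]_n) (B : {fset 'cV[int]_n}).

Lemma kerZ_step B v : (forall g, g \in B -> in_kerZ M g) ->
  (v \in B) || (- v \in B) -> in_kerZ M v.
Proof. by move=> kB /orP[/kB//|/kB/kerZN]; rewrite opprK. Qed.

(** A vector conformal to [w - u] moves [w] towards [u] in every coordinate without overshooting, so
    the walk stays nonnegative and [norm1 (w - u)] drops. *)
Lemma markov_basis_exists : exists B, markov_basis M B.
Proof.
have [G [GP GE]] := graver_exists M.
exists [fset g in G]%fset; split=> [v|w u w0 u0 kwu].
  by rewrite !inE => /GP[].
have [k] := ubnP (norm1 (w - u)); elim: k w w0 kwu => // k IHk w w0 kwu ltk.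
have [/subr0_eq ->|nz_wu] := eqVneq (w - u) 0.
  exact: markov_connected_refl.
have [g Gg gwu] := GE _ kwu nz_wu; have [kg nz_g] := GP g Gg.
apply: (markov_connected_step (v := g)) => //; first by rewrite !inE Gg.
apply: IHk.
- by move=> i; have := gwu i; have := w0 i; have := u0 i; rewrite !vecE; lia.
- by rewrite addrAC; apply: kerZB.
- rewrite -ltnS; apply: leq_trans ltk; rewrite !ltnS (conformal_norm1 gwu).
  by rewrite addrAC -add1n leq_add2r norm1_gt0.
Qed.

Lemma minimal_markov_basis_exists : exists B, minimal_markov_basis M B.
Proof.
have [B mB] := markov_basis_exists.
have [k] := ubnP #|` B|; elim: k B mB => // k IHk B mB ltk.
have [[B' [ltB' mB']]|minB] :=
    classic (exists B', (B' `<` B)%fset /\ markov_basis M B').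
  by apply: IHk mB' _; apply: leq_trans (fproper_ltn_card ltB') _.
by exists B; split=> // B' ltB' mB'; apply: minB; exists B'.
Qed.

(** The fibre of [pos_part v] has only the points [pos_part v] and [pos_part (- v)], so the first
    nonzero step of a walk joining them is [v] itself. *)
Lemma indispensable B v : markov_basis M B -> in_kerZ M v -> v != 0 ->
  (forall x, in_kerZ M x -> nonneg_vec (pos_part v - x) -> x = 0 \/ x = v) ->
  (v \in B) || (- v \in B).
Proof.
move=> [kB cB] kv nz_v fib.
have := cB (pos_part v) (pos_part (- v)) (pos_part_ge0 v) (pos_part_ge0 (- v)).
rewrite -pos_partN subKr => /(_ kv).
move E: {1}(pos_part v) => w cw.
elim/markov_connected_ind: w / cw E => [_ /eqP|x w _ nwx xB IH wE].
  by rewrite -subr_eq0 subKr (negPf nz_v).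
rewrite -wE in nwx; have [x0|<-//] := fib x (kerZ_step kB xB) nwx.
by apply: IH; rewrite x0 subr0.
Qed.

(** If [v] split conformally into nonzero [a] and [v - a], walks in the fibres of the two parts
    would replace every step by [v] or [- v], and [B] without [v] would still be a Markov basis. *)
Lemma minimal_indecomposable B v :
    (forall x, in_kerZ M x -> nonneg_vec x -> x = 0) ->
    minimal_markov_basis M B -> v \in B ->
  forall a, in_kerZ M a -> conformal a v -> a = 0 \/ a = v.
Proof.
move=> pointed [[kB cB] minB] vB a ka av.
have [->|nz_a] := eqVneq a 0; [by left|right].
apply/eqP; apply: contraT; rewrite -subr_eq0 -oppr_eq0 opprB => nz_b.
case: (minB (B `\ v)%fset); first exact: fproperD1.
split=> [x|w u w0 u0 kwu]; first by rewrite !inE => /andP[_ /kB].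
have kv := kB v vB.
(* In the fibre of [pos_part x] no step by [v] or [- v] is possible:
   it would leave a nonzero nonnegative vector of the kernel. *)
have avoid e x : e = v \/ e = - v -> in_kerZ M x -> conformal x e ->
    e - x != 0 -> markov_connected (B `\ v)%fset (pos_part x) (pos_part (- x)).
  move=> ev kx xe nz_y.
  have ke : in_kerZ M e by case: ev => ->; last apply: kerZN.
  have := cB (pos_part x) (pos_part (- x)) (pos_part_ge0 x) (pos_part_ge0 (- x)).
  rewrite -pos_partN subKr => /(_ kx) cx.
  (* The trivial kernel condition is added so that, once the start is generalised to [y], it records
     that [y] lies in the fibre. *)
  suff : in_kerZ M (pos_part x - pos_part x) ->
    markov_connected (B `\ v)%fset (pos_part x) (pos_part x - x).
    by apply; rewrite subrr; apply: kerZ0.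
  move: {1 3 5}(pos_part x) cx => y.
  elim/markov_connected_ind: y / => [n0 _|s y y0 ys sB IH ky].
    exact: markov_connected_refl.
  have ks := kerZ_step kB sB.
  have nosplit z : in_kerZ M z -> nonneg_vec (- z) -> z = 0.
    move=> kz nz; rewrite -[z]opprK (pointed (- z)) ?oppr0 //.
    exact: kerZN.
  have se : ~ (s = e \/ s = - e).
    move=> se; case/negP: nz_y; apply/eqP.
    case: se => se; rewrite se in ys.
      (* Here [y] dominates [pos_part e], hence [pos_part x]; pointedness gives equality, and then
         [e] lies below [x] in every coordinate. *)
      have yE : y - pos_part x = 0.
        apply: pointed => // i; have := y0 i; have := ys i; have := xe i.
        by rewrite !vecE; lia.
      apply: nosplit; first exact: kerZB.
      move=> i; have /matrixP/(_ i 0) := yE; have := ys i; have := xe i.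
      by rewrite !vecE; lia.
    have yE : y - (pos_part x - x) = 0.
      apply: pointed => [|i]; first by rewrite opprB addrCA addrC; apply: kerZD.
      by have := y0 i; have := ys i; have := xe i; rewrite !vecE; lia.
    apply: pointed; first exact: kerZB.
    move=> i; have /matrixP/(_ i 0) := yE; have := ys i; have := xe i.
    by rewrite !vecE; lia.
  apply: (markov_connected_step (v := s)) => //; last first.
    by apply: IH; rewrite addrAC; apply: kerZB.
  rewrite !inE; case/orP: sB => -> ; rewrite andbT.
    apply/orP; left; apply: contra_notN se => /eqP ->.
    by case: ev => ->; rewrite ?opprK; [left|right].
  apply/orP; right; apply: contra_notN se => /eqP sv; rewrite -[s]opprK sv.
  by case: ev => ->; rewrite ?opprK; [right|left].
(* A step by [e] becomes two walks, one in the fibre of [pos_part c] and one in that of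
   [pos_part (e - c)], with the nonnegative rest [z] carried along. *)
have step e x : e = v \/ e = - v -> nonneg_vec x -> nonneg_vec (x - e) ->
    markov_connected (B `\ v)%fset x (x - e).
  move=> ev x0 xe0.
  have [c [kc ce nz_c nz_ec]] : exists c, [/\ in_kerZ M c, conformal c e,
      c != 0 & e - c != 0].
    case: ev => ->; [exists a|exists (- a)]; split=> //.
    + exact: kerZN.
    + exact: conformalN.
    + by rewrite oppr_eq0.
    + by rewrite -opprD oppr_eq0.
  have ke : in_kerZ M e by case: ev => ->; last apply: kerZN.
  set z := x - pos_part e.
  have z0 : nonneg_vec z.
    by move=> i; have := x0 i; have := xe0 i; rewrite !vecE; lia.
  have -> : x = pos_part c + (pos_part (e - c) + z).
    by rewrite addrA -pos_part_conformal // /z addrC subrK.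
  have -> : pos_part c + (pos_part (e - c) + z) - e =
     pos_part (- (e - c)) + (pos_part (- c) + z).
    by apply: colP0 => i; have := ce i; rewrite !vecE; lia.
  have nnD p q : nonneg_vec p -> nonneg_vec q -> nonneg_vec (p + q).
    by move=> p0 q0 i; rewrite mxE addr_ge0.
  apply: (@markov_connected_trans _ _ (pos_part (- c) + (pos_part (e - c) + z))).
    apply: markov_connected_shift; first exact/nnD/z0/pos_part_ge0.
    exact: avoid ev kc ce nz_ec.
  rewrite addrCA; apply: markov_connected_shift; first exact/nnD/z0/pos_part_ge0.
  apply: avoid ev (kerZB ke kc) (conformalB ce) _.
  by rewrite opprB addrCA subrr addr0.
have := cB w u w0 u0 kwu.
elim/markov_connected_ind: w / {w0 kwu} => [_|s w w0 ws sB IH].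
  exact: markov_connected_refl.
have [ev|sv] := classic (s = v \/ s = - v).
  exact: markov_connected_trans (step _ _ ev w0 ws) IH.
apply: markov_connected_step w0 _ IH.
rewrite !inE; case/orP: sB => ->; rewrite andbT.
  by apply/orP; left; apply: contra_notN sv => /eqP; left.
apply/orP; right; apply: contra_notN sv => /eqP <-.
by rewrite opprK; right.
Qed.

End MarkovBases.

(** * Nonnegative combinations of Graver elements *)

Lemma split_sum (I : finType) (a : I -> nat) (b : nat) :
  (b <= \sum_i a i)%N ->
  exists c : I -> nat, (forall i, c i <= a i)%N /\ (\sum_i c i = b)%N.
Proof.
elim: b => [_|b IHb ltb]; first by exists (fun=> 0%N); rewrite big1.
have [c [ca cb]] := IHb (ltnW ltb).
have /existsP[i lti] : [exists i, (c i < a i)%N].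
  apply: contraLR ltb; rewrite negb_exists -leqNgt -cb => /forallP ac.
  by apply: leq_sum => i _; rewrite leqNgt ac.
exists (fun j => c j + (j == i))%N; split=> [j|].
  by have [->|_] := eqVneq j i; rewrite ?addn1 ?addn0.
rewrite big_split /= cb (bigD1 i) //= eqxx big1 ?addn0 ?addn1 // => j.
by move/negPf->.
Qed.

Section GraverSums.
Variables (n k : nat) (g : 'I_k -> 'cV[int]_n).
Implicit Types (x : 'cV[int]_n) (lam : 'I_k -> nat).

(** Every [g j] that occurs shares the signs of [x], so nothing cancels in the sums. *)
Lemma conformal_sum x lam lam1 lam2 :
  (forall j, (0 < lam j)%N -> conformal (g j) x) ->
  (forall j, lam2 j <= lam j)%N -> (forall j, lam1 j <= lam2 j)%N ->
  conformal (\sum_j g j *+ lam1 j) (\sum_j g j *+ lam2 j).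
Proof.
move=> gx le2 le1 i.
have sumE mu : (\sum_j g j *+ mu j) i 0 = \sum_j g j i 0 *+ mu j.
  by rewrite summxE; apply: eq_bigr => j _; rewrite mulmxnE.
rewrite !sumE.
have gxi j : (lam1 j = 0 /\ lam2 j = 0)%N \/
    (0 <= g j i 0 <= x i 0) || (x i 0 <= g j i 0 <= 0).
  have [z|/gx/(_ i)] := posnP (lam j); [left|by right].
  by have := le1 j; have := le2 j; lia.
have [x0|x0] := leP 0 (x i 0); apply/orP; [left|right].
  have g0 j : 0 <= g j i 0 \/ (lam1 j = 0 /\ lam2 j = 0)%N.
    by case: (gxi j) => [|gj]; [right|left; lia].
  apply/andP; split; [apply: sumr_ge0|apply: ler_sum] => j _.
    by case: (g0 j) => [/mulrn_wge0 //|[-> _]].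
  by case: (g0 j) => [/ler_wpMn2l -> //|[-> ->]].
have g0 j : g j i 0 <= 0 \/ (lam1 j = 0 /\ lam2 j = 0)%N.
  by case: (gxi j) => [|gj]; [right|left; lia].
apply/andP; split; [apply: ler_sum|apply: sumr_le0] => j _.
  by case: (g0 j) => [/ler_wnMn2l -> //|[-> ->]].
by case: (g0 j) => [/mulrn_wle0 //|[-> _]].
Qed.

(** Greedy choice: subtracting a conformal [g j] lowers [norm1], and what is conformal to the
    remainder is conformal to [x]. *)
Lemma graver_sum (P : 'cV[int]_n -> Prop) :
  (forall x j, P x -> P (x - g j)) ->
  (forall j, g j != 0) ->
  (forall x, P x -> x != 0 -> exists j, conformal (g j) x) ->
  forall x, P x -> exists lam : 'I_k -> nat,
    x = \sum_j g j *+ lam j /\ forall j, (0 < lam j)%N -> conformal (g j) x.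
Proof.
move=> Pg nz_g gE x; have [b] := ubnP (norm1 x).
elim: b x => // b IHb x ltb Px.
have [->|nz_x] := eqVneq x 0.
  by exists (fun=> 0%N); split=> //; rewrite big1.
have [i gix] := gE x Px nz_x.
have [|lam [xE lamP]] := IHb (x - g i) _ (Pg x i Px).
  rewrite -ltnS; apply: leq_trans ltb; rewrite !ltnS (conformal_norm1 gix).
  by rewrite -add1n leq_add2r norm1_gt0.
exists (fun j => lam j + (j == i))%N; split=> [|j].
  under eq_bigr do rewrite mulrnDr.
  rewrite big_split /= -xE (bigD1 i) //= eqxx big1 ?addr0 ?subrK // => j.
  by move/negPf->; rewrite mulr0n.
have [-> //|_] := eqVneq j i; rewrite addn0 => /lamP gjx c.
by have := gjx c; have := gix c; rewrite !vecE; lia.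
Qed.

End GraverSums.

(** * Uniform bound on types in Lawrence liftings *)

Section Lawrence.
Variables (m n : nat) (A : 'M[int]_(m, n)).

Lemma kerZ_lawrence r (v : 'cV[int]_(\sum_(j < r) n)) :
  in_kerZ (lawrence_lifting A r) v <->
  (forall i, in_kerZ A (submxcol v i)) /\ \sum_i submxcol v i = 0.
Proof.
have rowE i : (row i (lawrence_mx v))^T = submxcol v i by rewrite rowK trmxK.
have sumE : (\sum_i row i (lawrence_mx v))^T = \sum_i submxcol v i.
  by rewrite raddf_sum; apply: eq_bigr => i _; apply: rowE.
rewrite in_kerZ_lawrenceP; split=> -[kv sv]; split=> [i|].
- by rewrite -rowE.
- by rewrite -sumE sv trmx0.
- by rewrite rowE.
- by apply: (can_inj (@trmxK _ _ _)); rewrite sumE sv trmx0.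
Qed.

Lemma lawrence_typeE r (v : 'cV[int]_(\sum_(j < r) n)) :
  lawrence_type v = #|[set i | submxcol v i != 0]|.
Proof.
by apply: eq_card => i; rewrite !inE rowK trmx_eq0.
Qed.

Lemma nonneg_lawrence r (v : 'cV[int]_(\sum_(j < r) n)) :
  nonneg_vec v -> forall i, nonneg_vec (submxcol v i).
Proof. by move=> v0 i j; rewrite mxE. Qed.

Lemma conformal_lawrence r (a v : 'cV[int]_(\sum_(j < r) n)) :
  (forall i, conformal (submxcol a i) (submxcol v i)) -> conformal a v.
Proof.
move=> av i; rewrite -[a]submxcolK -[v]submxcolK !mxE.
by have := av (tagnat.sig1 i) (tagnat.sig2 i); rewrite !mxE.
Qed.

(** Nonnegative rows that sum to zero must all vanish. *)
Lemma lawrence_pointed r (v : 'cV[int]_(\sum_(j < r) n)) :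
  in_kerZ (lawrence_lifting A r) v -> nonneg_vec v -> v = 0.
Proof.
move=> /kerZ_lawrence[_ sv] /nonneg_lawrence v0.
apply/mxcolP => i; rewrite submxcol0; apply: colP0 => j.
have /matrixP/(_ j 0) := sv; rewrite summxE vecE => /psumr_eq0P -> //.
by move=> i' _; apply: v0.
Qed.

(* Conformal decompositions of the rows into Graver elements turn [v] into a
   nonnegative relation [Lam] between those elements.  A minimal relation below
   [Lam] splits among the rows, hence gives a conformal part of [v]; this part
   is [v] itself, and the minimal relation bounds its type. *)
Lemma lawrence_type_bound : exists c : nat,
  forall r (v : 'cV[int]_(\sum_(j < r) n)),
    in_kerZ (lawrence_lifting A r) v ->
    (forall a, in_kerZ (lawrence_lifting A r) a -> conformal a v ->
       a = 0 \/ a = v) ->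
    (lawrence_type v <= c)%N.
Proof.
have [G [GP GE]] := graver_exists A.
pose k := size G; pose g (j : 'I_k) := tnth (in_tuple G) j.
have gP j : in_kerZ A (g j) /\ g j != 0 by apply/GP/mem_tnth.
have gE x : in_kerZ A x -> x != 0 -> exists j, conformal (g j) x.
  move=> kx /(GE x kx)[y /(@tnthP _ _ (in_tuple G))[j ->] yx].
  by exists j.
have ksum lam : in_kerZ A (\sum_j g j *+ lam j).
  apply: big_rec => [|j x _]; first exact: kerZ0.
  by apply: kerZD; apply: kerZMn; case: (gP j).
have [l [lP lE]] := dickson
  (fun (j : 'I_k) (Lam : {ffun 'I_k -> nat}) => Lam j) (enum 'I_k)
  (fun Lam => (exists j, 0 < Lam j)%N /\ \sum_j g j *+ Lam j = 0).
(* Each nonzero row uses up at least one Graver element, so a relation occupies at most as many rows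
   as its coefficient sum. *)
exists (\max_(Lam <- l) \sum_j Lam j)%N => r v kv indec.
have typeP lam : (forall i, submxcol v i = \sum_j g j *+ lam i j) ->
    (lawrence_type v <= \sum_i \sum_j lam i j)%N.
  move=> vE; rewrite lawrence_typeE -sum1_card big_mkcond /=.
  apply: leq_sum => i _; rewrite inE vE; case: eqP => //= nz.
  rewrite lt0n; apply: contra_notN nz; rewrite sum_nat_eq0 => /forallP z.
  by rewrite big1 // => j _; rewrite (eqP (z j)).
have [kvi sv] := (kerZ_lawrence v).1 kv.
have := fun i => graver_sum (fun x j kx => kerZB kx (gP j).1)
  (fun j => (gP j).2) gE (kvi i).
move=> /fin_all_exists[lam lamP].
pose Lam : {ffun 'I_k -> nat} := [ffun j => (\sum_i lam i j)%N].
have sumLam (mu : 'I_r -> 'I_k -> nat) (Mu : 'I_k -> nat) :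
    (forall j, \sum_i mu i j = Mu j)%N ->
    \sum_i \sum_j g j *+ mu i j = \sum_j g j *+ Mu j.
  move=> MuE; rewrite exchange_big /=; apply: eq_bigr => j _.
  by rewrite -MuE sumrMnr.
have LamE j : (\sum_i lam i j = Lam j)%N by rewrite ffunE.
have [/existsP Lam_gt0|] := boolP [exists j, (0 < Lam j)%N]; last first.
  rewrite negb_exists => /forallP Lam0.
  apply: leq_trans (typeP lam (fun i => (lamP i).1)) _.
  rewrite exchange_big big1 //= => j _; rewrite LamE.
  by have := Lam0 j; lia.
have [|Mu lMu MuLam] := lE Lam.
  split=> //; rewrite -(sumLam lam) // -[RHS]sv.
  by apply: eq_bigr => i _; case: (lamP i).
have [[j0 Mu_gt0] Mu0] := lP Mu lMu.
(* The coefficients of [Mu] are distributed over the rows, row [i] supplying at most its own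
   [lam i j]. *)
have /fin_all_exists[mu muP] j : exists c : 'I_r -> nat,
    (forall i, c i <= lam i j)%N /\ (\sum_i c i = Mu j)%N.
  by apply: split_sum; rewrite LamE MuLam // mem_enum.
pose a := \mxcol_(i < r) \sum_j g j *+ mu j i.
have aE i : submxcol a i = \sum_j g j *+ mu j i by rewrite mxcolK.
have ka : in_kerZ (lawrence_lifting A r) a.
  apply/kerZ_lawrence; split=> [i|]; first by rewrite aE.
  under eq_bigr do rewrite aE.
  by rewrite (sumLam (fun i j => mu j i) Mu) // => j; case: (muP j).
have av : conformal a v.
  apply: conformal_lawrence => i; rewrite aE (lamP i).1.
  apply: conformal_sum (lamP i).2 _ _ => // j.
  by case: (muP j).
have [a0|aev] := indec a ka av; last first.
  apply: leq_trans (typeP (fun i j => mu j i) _) _ => [i|].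
    by rewrite -aE aev.
  rewrite exchange_big /=; under eq_bigr do rewrite (muP _).2.
  exact: leq_bigmax_seq.
(* The case [a = 0] is impossible: an element [g j0] used in row [i0] would be conformal to the zero
   row, hence zero. *)
have [i0 mu_gt0] : exists i, (0 < mu j0 i)%N.
  apply/existsP; apply: contraLR Mu_gt0; rewrite negb_exists => /forallP z.
  rewrite -(muP j0).2 big1 // => i _; have := z i; lia.
have : conformal (\sum_j g j *+ (j == j0)) (\sum_j g j *+ mu j i0).
  apply: conformal_sum (lamP i0).2 _ _ => [j|j]; first by case: (muP j).
  by have [->|] := eqVneq j j0.
rewrite -aE a0 submxcol0 (bigD1 j0) //= eqxx big1 => [|j /negPf->]; last first.
  by rewrite mulr0n.
rewrite addr0 mulr1n => gj0; case/negP: (gP j0).2; apply/eqP/colP0 => c.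
by have := gj0 c; rewrite !vecE; lia.
Qed.

End Lawrence.

(** * Attainment of the Markov complexity *)

Lemma markov_complexity_exists m n (A : 'M[int]_(m, n)) r
    (v : 'cV[int]_(\sum_(j < r) n)) :
  (2 <= r)%N -> in_universal_markov_basis (lawrence_lifting A r) v ->
  exists2 c, is_markov_complexity A c & (lawrence_type v <= c)%N.
Proof.
have [b bP] := lawrence_type_bound A.
have bound r' (w : 'cV[int]_(\sum_(j < r') n)) :
    in_universal_markov_basis (lawrence_lifting A r') w ->
    (lawrence_type w <= b)%N.
  move=> [B minB Bw]; apply: bP; first by case: minB => [[kB _] _]; apply: kB.
  exact: minimal_indecomposable (@lawrence_pointed _ _ A r') minB Bw.
(* Types are at most [b], so passing to an element of larger type while one exists terminates. *)
have [k] := ubnP (b - lawrence_type v)%N.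
elim: k r v => // k IHk r v ltk r2 uv.
have [[r' [w [r'2 uw lt_vw]]]|vmax] := classic (exists r'
    (w : 'cV[int]_(\sum_(j < r') n)), [/\ (2 <= r')%N,
    in_universal_markov_basis (lawrence_lifting A r') w
    & (lawrence_type v < lawrence_type w)%N]).
  have [|c cA wc] := IHk r' w _ r'2 uw; first by have := bound _ _ uw; lia.
  by exists c => //; apply: leq_trans wc; apply: ltnW.
exists (lawrence_type v) => //; split; first by exists r, v.
move=> r' w r'2 uw; rewrite leqNgt; apply/negP => lt_vw.
by apply: vmax; exists r', w.
Qed.

Lemma indispensable_universal d n (M : 'M[int]_(d, n)) (v : 'cV[int]_n) :
  in_kerZ M v -> v != 0 ->
  (forall x, in_kerZ M x -> nonneg_vec (pos_part v - x) -> x = 0 \/ x = v) ->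
  in_universal_markov_basis M v \/ in_universal_markov_basis M (- v).
Proof.
move=> kv nz_v fib; have [B minB] := minimal_markov_basis_exists M.
by have /orP[] := indispensable minB.1 kv nz_v fib; [left|right]; exists B.
Qed.

Lemma lawrence_typeN n r (v : 'cV[int]_(\sum_(j < r) n)) :
  lawrence_type (- v) = lawrence_type v.
Proof.
rewrite !lawrence_typeE; apply: eq_card => i.
by rewrite !inE submxcolN oppr_eq0.
Qed.

(** * The monomial curve and its three two-element fibres *)

Section Curve.
Variable N : nat.

Definition vec4 (a b c d : int) : 'cV[int]_4 :=
  \col_i nth 0 [:: a; b; c; d] i.

Definition curve_mx : 'M[int]_(2, 4) :=
  \matrix_(i, j) nth 0 (if i == 0 then [:: 1; 1; 1; 1]
                        else [:: 0; 1; N.+1%:Z; N.+2%:Z]) j.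

Local Notation ent x k := ((x : 'cV[int]_4) (inord k) 0).

Lemma vec4P (x y : 'cV[int]_4) :
  ent x 0 = ent y 0 -> ent x 1 = ent y 1 ->
  ent x 2 = ent y 2 -> ent x 3 = ent y 3 -> x = y.
Proof.
move=> e0 e1 e2 e3; apply: colP0 => i; rewrite -(inord_val i).
by case: i => [[|[|[|[|//]]]]].
Qed.

Lemma vec4E a b c d : ((ent (vec4 a b c d) 0 = a) * (ent (vec4 a b c d) 1 = b) *
  (ent (vec4 a b c d) 2 = c) * (ent (vec4 a b c d) 3 = d))%type.
Proof. by rewrite !mxE !inordK. Qed.

Lemma sum4 (F : 'I_4 -> int) : \sum_i F i =
  F (inord 0) + F (inord 1) + F (inord 2) + F (inord 3).
Proof.
rewrite (eq_bigr (fun i : 'I_4 => F (inord i))) => [|i _]; last first.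
  by rewrite inord_val.
rewrite -(big_mkord xpredT (fun i => F (inord i))) !big_nat_recr // big_geq //=.
by rewrite add0r.
Qed.

Lemma kerZ_curve (x : 'cV[int]_4) : in_kerZ curve_mx x <->
  ent x 0 + ent x 1 + ent x 2 + ent x 3 = 0 /\
  ent x 1 + N.+1%:Z * ent x 2 + N.+2%:Z * ent x 3 = 0.
Proof.
have E0 : (curve_mx *m x) 0 0 = ent x 0 + ent x 1 + ent x 2 + ent x 3.
  by rewrite mxE sum4 !mxE /= !inordK //= !mul1r.
have E1 : (curve_mx *m x) 1 0 = ent x 1 + N.+1%:Z * ent x 2 + N.+2%:Z * ent x 3.
  by rewrite mxE sum4 !mxE /= !inordK //= mul0r mul1r add0r.
rewrite -E0 -E1 /in_kerZ; split=> [->|[e0 e1]]; first by rewrite !mxE.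
apply: colP0 => i; rewrite vecE.
case: i => [[|[|//]]] p; [rewrite -e0|rewrite -e1].
all: by congr (_ _ 0); apply: val_inj.
Qed.

(** The positive parts are the exponents of [x0^N x2], [x1 x3^N] and [x1 x2]. *)
Definition row_first := vec4 N%:Z (- N.+1%:Z) 1 0.
Definition row_second := vec4 0 1 (- N.+1%:Z) N%:Z.
Definition row_other := vec4 (-1) 1 1 (-1).

Definition two_point_fiber (u : 'cV[int]_4) := forall x,
  in_kerZ curve_mx x -> nonneg_vec (pos_part u - x) -> x = 0 \/ x = u.

Lemma fiber_bounds (u x : 'cV[int]_4) : nonneg_vec (pos_part u - x) ->
  [/\ ent x 0 <= Num.max (ent u 0) 0, ent x 1 <= Num.max (ent u 1) 0,
      ent x 2 <= Num.max (ent u 2) 0 & ent x 3 <= Num.max (ent u 3) 0].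
Proof.
move=> ux; have ux' k : ent x k <= Num.max (ent u k) 0.
  by have := ux (inord k); rewrite !vecE subr_ge0.
by split.
Qed.

Lemma fiber_first : two_point_fiber row_first.
Proof.
move=> x /kerZ_curve[e0 e1] /fiber_bounds; rewrite !vec4E => -[l0 l1 l2 l3].
(* A negative last entry would bring the weighted sum in [e1] down to at most [N + 1 - (N + 2)]. *)
have x3 : ent x 3 = 0 by nia.
rewrite x3 in e0 e1.
have [x2|x2] : ent x 2 = 0 \/ ent x 2 = 1 by nia.
  by left; apply: vec4P; rewrite !vecE; nia.
by right; apply: vec4P; rewrite !vec4E; nia.
Qed.

(** Mirror image of [fiber_first]: reversing the exponents preserves the curve and exchanges
    [row_first] and [row_second]. *)
Lemma fiber_second : two_point_fiber row_second.
Proof.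
move=> x /kerZ_curve[e0 e1] /fiber_bounds; rewrite !vec4E => -[l0 l1 l2 l3].
have x0 : ent x 0 = 0 by nia.
have [x1|x1] : ent x 1 = 0 \/ ent x 1 = 1 by nia.
  by left; apply: vec4P; rewrite !vecE; nia.
by right; apply: vec4P; rewrite !vec4E; nia.
Qed.

Lemma fiber_other : (0 < N)%N -> two_point_fiber row_other.
Proof.
move=> N_gt0 x /kerZ_curve[e0 e1] /fiber_bounds; rewrite !vec4E => -[l0 l1 l2 l3].
(* The two middle entries are at most 1, so [e1] forbids a last entry below -1. *)
have [x3|x3] : ent x 3 = 0 \/ ent x 3 = -1 by nia.
  have x2 : ent x 2 = 0.
    (* The bounds and [e0] leave three values for this entry; [e1] and [N_gt0] exclude the nonzero
       ones. *)
    by have [|[|]] : ent x 2 = 1 \/ ent x 2 = 0 \/ ent x 2 = -1 by [lia]; nia.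
  by left; apply: vec4P; rewrite !vecE; nia.
have x2 : ent x 2 = 1.
  by have [|[|]] : ent x 2 = 1 \/ ent x 2 = 0 \/ ent x 2 = -1 by [lia]; nia.
by right; apply: vec4P; rewrite !vec4E; nia.
Qed.

End Curve.

(** * The indispensable move of type [N + 2] *)

Definition curve_row N (i : nat) : 'cV[int]_4 :=
  match i with 0 => row_first N | 1 => row_second N | _ => row_other end.

Definition curve_move N : 'cV[int]_(\sum_(j < N.+2) 4) :=
  \mxcol_(i < N.+2) curve_row N i.

Section Move.
Variable N : nat.

Lemma curve_row_fiber i : (0 < N)%N -> two_point_fiber N (curve_row N i).
Proof.
case: i => [|[|i]] N_gt0; [exact: fiber_first|exact: fiber_second|].
exact: fiber_other.
Qed.

Lemma kerZ_curve_row i : in_kerZ (curve_mx N) (curve_row N i).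
Proof.
by case: i => [|[|i]]; apply/kerZ_curve; rewrite !vec4E; split; nia.
Qed.

Lemma curve_row_neq0 i : curve_row N i != 0.
Proof.
apply/eqP => /(congr1 (fun x : 'cV[int]_4 => x (inord 1) 0)).
by case: i => [|[|i]]; rewrite vec4E vecE.
Qed.

Lemma submxcol_curve_move i : submxcol (curve_move N) i = curve_row N i.
Proof. by rewrite mxcolK. Qed.

Lemma kerZ_curve_move :
  in_kerZ (lawrence_lifting (curve_mx N) N.+2) (curve_move N).
Proof.
apply/kerZ_lawrence; split=> [i|].
  by rewrite submxcol_curve_move; apply: kerZ_curve_row.
under eq_bigr do rewrite submxcol_curve_move.
rewrite !big_ord_recl /= sumr_const card_ord.
by apply: vec4P; rewrite !vecE mulmxnE !vec4E; lia.
Qed.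

Lemma curve_move_type : lawrence_type (curve_move N) = N.+2.
Proof.
rewrite lawrence_typeE -[RHS]card_ord; apply: eq_card => i.
by rewrite !inE submxcol_curve_move curve_row_neq0.
Qed.

(* Every row of [x] is either zero or the row of [curve_move N], and
   [row_first N + row_second N + N row_other = 0] generates the relations
   between the three vectors. *)
Lemma curve_move_fiber x : (0 < N)%N ->
  in_kerZ (lawrence_lifting (curve_mx N) N.+2) x ->
  nonneg_vec (pos_part (curve_move N) - x) -> x = 0 \/ x = curve_move N.
Proof.
move=> N_gt0 /kerZ_lawrence[kx sx] nx.
have xP i : submxcol x i = 0 \/ submxcol x i = curve_row N i.
  apply: curve_row_fiber => // j.
  have := nonneg_lawrence nx i j; rewrite -submxcol_curve_move.
  by rewrite !mxE.
pose i0 : 'I_N.+2 := ord0; pose i1 : 'I_N.+2 := lift ord0 ord0.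
pose up (i : 'I_N) : 'I_N.+2 := lift ord0 (lift ord0 i).
have rowsP y : submxcol x i0 = submxcol y i0 -> submxcol x i1 = submxcol y i1 ->
    (forall i, submxcol x (up i) = submxcol y (up i)) -> x = y.
  move=> e0 e1 eup; apply/mxcolP => i.
  case: (unliftP ord0 i) => [j ->|-> //].
  by case: (unliftP ord0 j) => [l ->|-> //]; apply: eup.
(* [t] is minus the indicator of the rows past the second in which [x] agrees with
   [curve_move N]. *)
pose t i : int := submxcol x (up i) (inord 0) 0.
have tP i : (submxcol x (up i) = 0 /\ t i = 0) \/
            (submxcol x (up i) = row_other /\ t i = -1).
  by case: (xP (up i)) => e; [left|right]; rewrite /t e ?vecE ?vec4E.
have sum_eq0 (f : 'I_N -> int) :
    (forall i, 0 <= f i) -> \sum_i f i = 0 -> forall i, f i = 0.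
  by move=> f0 /psumr_eq0P fE i; apply: fE.
have coord k : submxcol x i0 (inord k) 0 + (submxcol x i1 (inord k) 0 +
    \sum_i submxcol x (up i) (inord k) 0) = 0.
  have := congr1 (fun y : 'cV[int]_4 => y (inord k) 0) sx.
  by rewrite summxE !big_ord_recl vecE.
(* In coordinate 0 only [row_first] offsets the entries -1 of the later rows, in coordinate 3 only
   [row_second]. Both have the entry [N] there, so the number of nonzero later rows is 0 or [N] and
   decides both. *)
have fst_coord : _ + (_ + \sum_i t i) = 0 := coord 0%N.
have lst_coord := coord 3%N.
have lastE : \sum_i (submxcol x (up i) (inord 3) 0) = \sum_i t i.
  apply: eq_bigr => i _; rewrite /t.
  by case: (xP (up i)) => ->; rewrite ?vecE //= !vec4E.
rewrite lastE in lst_coord.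
case: (xP i0) => x0; rewrite x0 ?vecE ?vec4E in fst_coord lst_coord.
  have t0 : \sum_i t i = 0.
    by case: (xP i1) => x1; rewrite x1 ?vecE ?vec4E in fst_coord; lia.
  left; apply: rowsP; rewrite ?submxcol0 //.
    case: (xP i1) => // x1; rewrite x1 vec4E t0 in lst_coord; lia.
  move=> i; rewrite submxcol0; case: (tP i) => [[]//|[_ ti]].
  have := sum_eq0 (fun i => - t i); rewrite sumrN t0 oppr0.
  suff ge0 j : 0 <= - t j by move/(_ ge0 erefl i); rewrite ti.
  by case: (tP j) => [] [_ ->].
have t0 : \sum_i t i = - N%:Z.
  by case: (xP i1) => x1; rewrite x1 ?vecE ?vec4E in fst_coord; lia.
right; apply: rowsP; rewrite ?submxcol_curve_move //.
  case: (xP i1) => // x1; rewrite x1 vecE t0 in lst_coord; lia.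
move=> i; rewrite submxcol_curve_move; case: (tP i) => [[_ ti]|[]//].
(* The terms [t i + 1] are nonnegative and sum to [- N + N], so every later row is [row_other]. *)
have := sum_eq0 (fun i => t i + 1).
rewrite big_split /= t0 sumr_const card_ord natz addNr.
suff ge0 j : 0 <= t j + 1 by move/(_ ge0 erefl i); rewrite ti.
by case: (tP j) => [] [_ ->].
Qed.

End Move.

Theorem theorem5p1 (N : nat) (N_gt0 : (0 < N)%N) :
  exists (A : 'M[int]_(2, 4)) (c : nat),
    is_markov_complexity A c /\ (N <= c)%N.
Proof.
have nz : curve_move N != 0.
  apply/eqP => /(congr1 (fun v => submxcol v ord0)).
  by rewrite submxcol_curve_move submxcol0; apply/eqP/curve_row_neq0.
exists (curve_mx N).
(* Only the move or its opposite is known to lie in the universal basis, but both have type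
   [N + 2]. *)
have [u|u] := indispensable_universal (kerZ_curve_move N) nz
  (fun x => curve_move_fiber N_gt0); have [//|c cA] := markov_complexity_exists _ u;
  rewrite ?lawrence_typeN curve_move_type => Nc;
  by exists c; split=> //; apply: leq_trans Nc; apply: leqW.
Qed.
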